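(* Suppose $\omega$ is a concave modulus of continuity. (i) If $\lim_{t \to 0} \frac{\omega(t)}{t} < \infty$, then $C^\omega[0,1]$ is the set of all Lipschitz functions $f:[0,1]\to\mathbb{R}$, and $\dim_{\mathrm{A}} G_f = 1$ for all $f \in C^\omega[0,1]$. (ii) Otherwise $\lim_{t \to 0} \frac{\omega(t)}{t} = \infty$, and then a typical $f \in (c^\omega[0,1], \|\cdot\|_\omega)$ satisfies $\dim_{\mathrm{A}} G_f = 2$. In particular, this holds in all little Hölder spaces, i.e. for $\omega(t)=t^\alpha$ with $\alpha\in(0,1)$.
   Context: A modulus of continuity is a function $\omega:[0,1]\to[0,\infty]$ that is increasing (meaning non-decreasing), satisfies $\omega(t)>0$ for $t>0$, and $\lim_{t\to 0}\omega(t)=\omega(0)=0$. For $f:[0,1]\to\mathbb{R}$ put $[f]_\omega=\sup_{x,y\in[0,1],\,x\neq y}\frac{|f(x)-f(y)|}{\omega(|x-y|)}$ and $\|f\|_\omega=\|f\|_\infty+[f]_\omega$. Let $C^\omega[0,1]=\{f:[0,1]\to\mathbb{R} : [f]_\omega<\infty\}$, and let $c^\omega[0,1]$ (the little $\omega$-space) be the set of all $f\in C^\omega[0,1]$ with $\lim_{t\to0}\sup\{\frac{|f(x)-f(y)|}{\omega(|x-y|)} : x,y\in[0,1],\ x\neq y,\ |x-y|\leq t\}=0$. Both are complete metric spaces under $\|\cdot\|_\omega$. In a complete metric space, a set is meagre if it is a countable union of nowhere dense sets, and residual if its complement is meagre; a typical element has a property if the set of elements having it is residual. $G_f=\{(x,f(x))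 : x\in[0,1]\}\subseteq\mathbb{R}^2$ is the graph of $f$. For non-empty $E\subseteq\mathbb{R}^d$ and $r>0$, $N_r(E)$ is the maximum number of pairwise disjoint closed balls of radius $r$ with centres in $E$. $B^o(x,R)$ is the open ball of radius $R$ centred at $x$. The Assouad dimension of a non-empty $F\subseteq\mathbb{R}^d$ is $$\dim_{\mathrm{A}}F=\inf\{\beta : \exists\, C>0 \text{ such that for all } 0<r<R \text{ and } x\in F,\ N_r(B^o(x,R)\cap F)\leq C(R/r)^\beta\}.$$ *)

(* Defs.v *)
From HB Require Import structures.
From mathcomp Require Import all_boot all_order all_algebra.
From mathcomp Require Import all_classical all_reals all_analysis.
From mathcomp Require Import lra.

Set Implicit Arguments.
Unset Strict Implicit.
Unset Printing Implicit Defensive.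

Import Order.TTheory GRing.Theory Num.Theory.
Import numFieldNormedType.Exports.

Local Open Scope classical_set_scope.
Local Open Scope ring_scope.
Local Open Scope ereal_scope.

(* The interval [0,1] as a type is [{i01 R}], with coercion to R [x%:num].    *)

(* Only the values of [modulus_fun] on [0,1] are constrained, and only these
   are used below. *)
Record modulus (R : realType) := Modulus {
  modulus_fun :> R -> \bar R ;
  modulus_ge0 : forall t : {i01 R}, 0 <= modulus_fun t%:num ;
  modulus_nondecreasing : forall s t : {i01 R},
    (s%:num <= t%:num)%R -> modulus_fun s%:num <= modulus_fun t%:num ;
  modulus_gt0 : forall t : {i01 R}, (0 < t%:num)%R -> 0 < modulus_fun t%:num ;
  modulus_0 : modulus_fun 0%R = 0 ;
  modulus_cvg : modulus_fun t @[t --> 0%R^'+] --> 0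
}.

Definition concave_modulus (R : realType) (w : modulus R) : Prop :=
  forall s t l : {i01 R},
    l%:num%:E * w s%:num + (1 - l%:num)%:E * w t%:num
      <= w (l%:num * s%:num + (1 - l%:num) * t%:num)%R.

Definition slope (R : realType) (w : modulus R) (t : R) : \bar R := w t / t%:E.

Definition finite_slope (R : realType) (w : modulus R) : Prop :=
  exists2 l : \bar R, l < +oo & slope w t @[t --> 0%R^'+] --> l.

Section omega_spaces.
Context {R : realType}.
Implicit Types (w : modulus R) (f : {i01 R} -> R).

Definition quotient w f (x y : {i01 R}) : \bar R :=
  `|f x - f y|%:E / w `|x%:num - y%:num|%R.

Definition seminorm w f : \bar R :=
  ereal_sup [set q | exists x y : {i01 R}, x != y /\ q = quotient w f x y].

Definition local_seminorm w f (t : R) : \bar R :=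
  ereal_sup [set q | exists x y : {i01 R},
    [/\ x != y, (`|x%:num - y%:num| <= t)%R & q = quotient w f x y]].

Definition supnorm f : \bar R := ereal_sup (range (fun x => `|f x|%:E)).

Definition omega_norm w f : \bar R := supnorm f + seminorm w f.

Definition big_omega w : set ({i01 R} -> R) := [set f | seminorm w f < +oo].

Definition is_little_omega w : set ({i01 R} -> R) :=
  big_omega w `&` [set f | local_seminorm w f t @[t --> 0%R^'+] --> 0].

Definition lipschitz_functions : set ({i01 R} -> R) :=
  [set f | exists k : R, forall x y : {i01 R},
    (`|f x - f y| <= k * `|x%:num - y%:num|)%R].

Record little_omega w := LittleOmega {
  little_omega_fun :> {i01 R} -> R ;
  little_omegaP : is_little_omega w little_omega_fun
}.

HB.instance Definition _ w := gen_eqMixin (little_omega w).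
HB.instance Definition _ w := gen_choiceMixin (little_omega w).

Definition omega_dist w (f g : little_omega w) : R :=
  fine (omega_norm w (f \- g)%R).

Lemma dist01 (x y : {i01 R}) :
  exists t : {i01 R}, t%:num = `|x%:num - y%:num|%R.
Proof.
have tP : (`|x%:num - y%:num| <= 1)%R.
  have [x0 x1] : (0 <= x%:num)%R /\ (x%:num <= 1)%R by [].
  have [y0 y1] : (0 <= y%:num)%R /\ (y%:num <= 1)%R by [].
  by rewrite ler_norml lerBrDr lerBlDr; apply/andP; split; lra.
by exists (Itv01 (normr_ge0 _) tP).
Qed.

Lemma modulus_dist_gt0 w (x y : {i01 R}) : x != y ->
  0 < w `|x%:num - y%:num|%R.
Proof.
move=> xy; have [t tE] := dist01 x y; rewrite -tE modulus_gt0// tE.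
by rewrite normr_gt0 subr_eq0.
Qed.

Lemma modulus_inv_ge0 w (x y : {i01 R}) : x != y ->
  0 <= (w `|x%:num - y%:num|%R)^-1.
Proof. by move=> /(modulus_dist_gt0 w) /ltW; rewrite inve_ge0. Qed.

Lemma quotient_ge0 w f x y : x != y -> 0 <= quotient w f x y.
Proof. by move=> xy; rewrite mule_ge0 ?lee_fin// modulus_inv_ge0. Qed.

Lemma quotient_le w f x y : x != y -> quotient w f x y <= seminorm w f.
Proof. by move=> xy; apply: ereal_sup_ubound; exists x, y. Qed.

Lemma seminorm_ge0 w f : 0 <= seminorm w f.
Proof.
have xy : Itv01 (lexx 0%R) ler01 != Itv01 ler01 (lexx 1%R) :> {i01 R}.
  by apply/eqP => /(congr1 (fun x => x%:num)) /= /eqP; rewrite eq_sym oner_eq0.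
exact: le_trans (quotient_ge0 w f xy) (quotient_le w f xy).
Qed.

Lemma supnorm_ge0 f : 0 <= supnorm f.
Proof.
apply: le_ereal_sup_tmp; exists `|f (Itv01 (lexx 0%R) ler01)|%:E.
  by exists (Itv01 (lexx 0%R) ler01).
by rewrite lee_fin.
Qed.

Lemma le_supnorm f x : `|f x|%:E <= supnorm f.
Proof. by apply: ereal_sup_ubound; exists x. Qed.

Lemma omega_norm_ge0 w f : 0 <= omega_norm w f.
Proof. by rewrite adde_ge0 ?supnorm_ge0 ?seminorm_ge0. Qed.

Lemma seminormD w f g : seminorm w (f \+ g)%R <= seminorm w f + seminorm w g.
Proof.
apply: ge_ereal_sup => _ [x [y [xy ->]]].
rewrite (le_trans _ (leeD (quotient_le w f xy) (quotient_le w g xy)))//.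
rewrite /quotient -ge0_muleDl ?lee_fin// lee_wpmul2r ?modulus_inv_ge0//.
by rewrite -EFinD lee_fin/= opprD addrACA ler_normD.
Qed.

Lemma supnormD f g : supnorm (f \+ g)%R <= supnorm f + supnorm g.
Proof.
apply: ge_ereal_sup => _ [x _ <-].
rewrite (le_trans _ (leeD (le_supnorm f x) (le_supnorm g x)))//.
by rewrite -EFinD lee_fin ler_normD.
Qed.

Lemma omega_normD w f g :
  omega_norm w (f \+ g)%R <= omega_norm w f + omega_norm w g.
Proof.
by rewrite /omega_norm addeACA leeD ?supnormD ?seminormD.
Qed.

Lemma omega_normN w f : omega_norm w (\- f)%R = omega_norm w f.
Proof.
congr (_ + _).
  by congr ereal_sup; congr image; apply/funext => x /=; rewrite normrN.
rewrite /seminorm; congr ereal_sup; apply/funext => q; apply/propext.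
have qE x y : quotient w (\- f)%R x y = quotient w f x y.
  by rewrite /quotient /= -opprD normrN.
by split=> -[x [y [xy ->]]]; exists x, y; rewrite qE.
Qed.

Lemma omega_norm0 w : omega_norm w (cst 0%R) = 0.
Proof.
apply/eqP; rewrite eq_le omega_norm_ge0 andbT -[leRHS]adde0 leeD//.
  by apply: ge_ereal_sup => _ [x _ <-]; rewrite normr0.
by apply: ge_ereal_sup => _ [x [y [xy ->]]]; rewrite /quotient subrr normr0 mul0e.
Qed.

Lemma supnorm_lty w f : seminorm w f < +oo -> supnorm f < +oo.
Proof.
move=> foo; have sfin : seminorm w f \is a fin_num.
  by rewrite ge0_fin_numE ?seminorm_ge0.
have [d [d0 d1 wd]] : exists d : R, [/\ (0 < d)%R, (d <= 1)%R & w d < 1].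
  have w1 : \forall t \near 0%R^'+, w t < 1.
    have := @modulus_cvg R w [set u | u < 1]; apply.
    exact: (open_ereal_lt' lte01).
  near (0%R : R)^'+ => d; exists d; split.
  - by near: d; exact: nbhs_right_gt.
  - by near: d; apply: nbhs_right_le.
  - by near: d.
pose K := fine (seminorm w f); have KE : seminorm w f = K%:E by rewrite fineK.
have K0 : (0 <= K)%R by rewrite fine_ge0// seminorm_ge0.
have step (x y : {i01 R}) : (`|x%:num - y%:num| <= d)%R -> (`|f x - f y| <= K)%R.
  move=> xyd; have [->|xy] := eqVneq x y; first by rewrite subrr normr0.
  have [t tE] := dist01 x y; have w0 := modulus_dist_gt0 w xy.
  have wt : w `|x%:num - y%:num|%R < 1.
    apply: le_lt_trans wd; rewrite -tE.
    have := @modulus_nondecreasing _ w t (Itv01 (ltW d0) d1).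
    by rewrite /= tE; apply.
  have := quotient_le w f xy; rewrite KE /quotient.
  case: (w _) w0 wt => [r| |]//; rewrite !lte_fin => r0 r1.
  rewrite inver gt_eqF// -EFinM lee_fin ler_pdivrMr// => /le_trans; apply.
  by rewrite ler_piMr// ltW.
pose o : {i01 R} := Itv01 (lexx 0%R) ler01.
have main n (x : {i01 R}) : (x%:num <= n%:R * d)%R ->
    (`|f x| <= `|f o| + n%:R * K)%R.
  elim: n x => [x|n IH x xn].
    rewrite mul0r => x0; have -> : x = o.
      by apply/val_inj/eqP; rewrite /= eq_le x0 /=.
    by rewrite mul0r addr0.
  have [xd|xd] := leP x%:num d.
    rewrite -[f x](subrK (f o)) (le_trans (ler_normD _ _))// addrC lerD2l.
    rewrite (le_trans (step _ _ _)) ?subr0 ?ger0_norm//.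
    by rewrite -[leLHS]mul1r ler_wpM2r// ler1n.
  have y0 : (0 <= x%:num - d)%R by rewrite subr_ge0 ltW.
  have y1 : (x%:num - d <= 1)%R.
    by rewrite lerBlDr (@le_trans _ _ 1%R)// lerDl ltW.
  rewrite -[f x](subrK (f (Itv01 y0 y1))) (le_trans (ler_normD _ _))//.
  have xyd : (`|x%:num - (Itv01 y0 y1)%:num| <= d)%R.
    by rewrite /= opprB addrCA subrr addr0 gtr0_norm.
  have yn : ((Itv01 y0 y1)%:num <= n%:R * d)%R.
    by rewrite /= lerBlDr -{2}[d]mul1r -mulrDl natr1.
  rewrite (le_trans (lerD (step _ _ xyd) (IH _ yn)))// addrCA lerD2l.
  by rewrite -{1}[K]mul1r -mulrDl nat1r.
have [n nd] : exists n : nat, (1 <= n%:R * d)%R.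
  exists (Num.truncn d^-1).+1.
  by rewrite -ler_pdivrMr// div1r ltW// truncnS_gt.
rewrite (@le_lt_trans _ _ (`|f o| + n%:R * K)%:E) ?ltry//.
apply: ge_ereal_sup => _ [x _ <-]; rewrite lee_fin main// (le_trans _ nd)//.
Unshelve. all: by end_near. Qed.

Lemma omega_dist_fin w (f g : little_omega w) :
  omega_norm w (f \- g)%R \is a fin_num.
Proof.
rewrite ge0_fin_numE ?omega_norm_ge0//.
have h (e : little_omega w) : omega_norm w e < +oo.
  have [elt _] := little_omegaP e.
  by rewrite lte_add_pinfty//; exact: supnorm_lty elt.
rewrite (le_lt_trans (omega_normD w f (\- g)%R))// lte_add_pinfty ?h//.
by rewrite omega_normN h.
Qed.

Lemma omega_distxx w (f : little_omega w) : omega_dist f f = 0%R.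
Proof.
rewrite /omega_dist (_ : (_ \- _)%R = cst 0%R) ?omega_norm0//.
by apply/funext => x /=; rewrite subrr.
Qed.

Lemma omega_dist_eq0 w (f g : little_omega w) : omega_dist f g = 0%R -> f = g.
Proof.
move=> d0; have {d0} fg x : f x = g x.
  have : `|f x - g x|%:E <= omega_norm w (f \- g)%R.
    exact: le_trans (le_supnorm (f \- g)%R x) (leeDl _ (seminorm_ge0 _ _)).
  rewrite -(fineK (omega_dist_fin f g)) -/(omega_dist f g) d0 lee_fin.
  by rewrite normr_le0 subr_eq0 => /eqP.
case: f g fg => [f pf] [g pg] /= fg.
have {}fg : f = g by apply/funext.
by subst g; congr LittleOmega; exact: Prop_irrelevance.
Qed.

Lemma omega_distC w (f g : little_omega w) : omega_dist f g = omega_dist g f.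
Proof.
rewrite /omega_dist -omega_normN; congr (fine (omega_norm w _)).
by apply/funext => x /=; rewrite opprB.
Qed.

Lemma omega_dist_triangle w (g f h : little_omega w) :
  (omega_dist f h <= omega_dist f g + omega_dist g h)%R.
Proof.
rewrite -lee_fin EFinD !fineK; try exact: omega_dist_fin.
have -> : (f \- h = (f \- g) \+ (g \- h))%R.
  by apply/funext => x /=; rewrite addrA subrK.
exact: omega_normD.
Qed.

HB.instance Definition _ w := @isMetric.Build R (little_omega w)
  (@omega_dist w) (@omega_distxx w) (@omega_dist_eq0 w) (@omega_distC w)
  (@omega_dist_triangle w).

End omega_spaces.

Arguments lipschitz_functions : clear implicits.

Section holder.
Context {R : realType}.
Variables (a : R) (a0 : (0 < a)%R).

Let h (t : R) : \bar R := (t `^ a)%:E.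

Let h_ge0 (t : {i01 R}) : 0 <= h t%:num.
Proof. by rewrite lee_fin powR_ge0. Qed.

Let h_nondecreasing (s t : {i01 R}) :
  (s%:num <= t%:num)%R -> h s%:num <= h t%:num.
Proof. by move=> st; rewrite lee_fin ge0_ler_powR ?nnegrE ?(ltW a0). Qed.

Let h_gt0 (t : {i01 R}) : (0 < t%:num)%R -> 0 < h t%:num.
Proof. by move=> t0; rewrite lte_fin powR_gt0. Qed.

Let h_0 : h 0%R = 0.
Proof. by rewrite /h powR0// gt_eqF. Qed.

Let h_cvg : h t @[t --> 0%R^'+] --> 0.
Proof. by apply: cvg_EFin => //; [exact: nearW | exact: powR_cvg0]. Qed.

Definition holder_modulus : modulus R :=
  Modulus h_ge0 h_nondecreasing h_gt0 h_0 h_cvg.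

End holder.

Section category.
Context {T : topologicalType}.

Definition nowhere_dense (A : set T) : Prop := interior (closure A) = set0.

Definition meagre (A : set T) : Prop :=
  exists2 F : (set T)^nat, (forall n, nowhere_dense (F n)) &
    A = \bigcup_n F n.

Definition residual (A : set T) : Prop := meagre (~` A).

End category.

Section assouad.
Context {R : realType} {d : nat}.
Implicit Types (x : 'rV[R]_d) (E F : set 'rV[R]_d).

(* The library norm on ['rV[R]_d] is the sup norm, hence the definition. *)
Definition euclidean_norm x : R := Num.sqrt (\sum_i x 0%R i ^+ 2)%R.

Definition open_eball x (r : R) : set 'rV[R]_d :=
  [set y | (euclidean_norm (y - x) < r)%R].

Definition closed_eball x (r : R) : set 'rV[R]_d :=
  [set y | (euclidean_norm (y - x) <= r)%R].

(* The maximum is taken in [\bar R]: it is +oo if there are arbitrarily large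
   families of disjoint balls. *)
Definition packing_number (r : R) E : \bar R :=
  ereal_sup [set n%:R%:E | n in [set n : nat |
    exists c : 'I_n -> 'rV[R]_d, (forall i, E (c i)) /\
      (forall i j, i != j ->
        closed_eball (c i) r `&` closed_eball (c j) r = set0)]].

Definition assouad_dim F : \bar R :=
  ereal_inf [set b%:E | b in [set b : R |
    exists2 C : R, (0 < C)%R & forall (r S : R) x,
      (0 < r)%R -> (r < S)%R -> F x ->
      packing_number r (open_eball x S `&` F) <= (C * (S / r) `^ b)%:E]].

End assouad.

Definition graph (R : realType) (f : {i01 R} -> R) : set 'rV[R]_2 :=
  [set z | exists x : {i01 R},
    z = \row_(i < 2) (if i == 0%R then x%:num else f x)].

(* Main.v *)
Require Import Defs.
From mathcomp Require Import all_boot all_order all_algebra.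
From mathcomp Require Import all_classical all_reals all_analysis.
From mathcomp Require Import ring lra.

(* Concavity makes w(t)/t nonincreasing.  If it stays bounded near 0 then w(t)
   is comparable to t, and the graph of a Lipschitz function is a bi-Lipschitz
   copy of [0,1].

   Otherwise w(t)/t tends to +oo.  Given f in the little
   space, g(x) = f(max(x,s)) + L u sin(x/u) is close to f in norm when s is small
   and u is tiny compared to s and 1/L: the first change costs the local
   seminorm of f at scale s, and the wave, of slope at most L, costs about
   L u + 2 L u / w(u).  On [0,s] the graph of g is a translate of that of the
   wave, which within a square of side O(L u) contains L^2 points that are
   pairwise u-separated; a sup-norm perturbation of size u/8 does not destroy
   this.  Hence functions whose graph satisfies the Assouad bound with constant
   C and exponent b < 2 form a nowhere dense set, because C (80 L)^b < L^2 for
   large L. *)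

Set Implicit Arguments.
Unset Strict Implicit.
Unset Printing Implicit Defensive.

Import Order.TTheory GRing.Theory Num.Theory.
Import numFieldNormedType.Exports.

Local Open Scope classical_set_scope.
Local Open Scope ring_scope.
Local Open Scope ereal_scope.

(** * Packings and the Assouad dimension of graphs *)

(** A smaller exponent loses for large [n], whatever the constants: it suffices that n^(e - b)
    exceeds C D^b. This refutes Assouad bounds with exponent [b] below [e = 1] for Lipschitz graphs
    and below [e = 2] for typical ones. *)
Lemma powR_natmul_lt (R : realType) (C D b e : R) :
  (0 < C)%R -> (0 < D)%R -> (b < e)%R ->
  exists2 n : nat, (0 < n)%N & (C * (D * n%:R) `^ b < n%:R `^ e)%R.
Proof.
move=> C0 D0 be; have eb0 : (0 < e - b)%R by rewrite subr_gt0.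
pose M := (C * D `^ b)%R; have M0 : (0 < M)%R by rewrite mulr_gt0 ?powR_gt0.
pose n := (Num.truncn (M `^ (e - b)^-1)).+1.
have n0 : (0 < n%:R :> R)%R by rewrite ltr0n.
exists n => //; rewrite powRM ?ltW// mulrA -/M.
rewrite -[e in ltRHS](subrK b) powRD; last by rewrite (gt_eqF n0) implybT.
rewrite ltr_pM2r ?powR_gt0//.
have -> : M = ((M `^ (e - b)^-1) `^ (e - b))%R.
  by rewrite -powRrM mulVf ?gt_eqF// powRr1// ltW.
by rewrite gt0_ltr_powR ?nnegrE ?powR_ge0 ?ltW// truncnS_gt.
Qed.

Lemma truncn_eq_dist (R : realType) (a b : R) : (0 <= a)%R -> (0 <= b)%R ->
  Num.truncn a = Num.truncn b -> (`|a - b| < 1)%R.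
Proof.
move=> /truncn_itv /andP[a1 a2] /truncn_itv /andP[b1 b2] ab.
move: a1 a2; rewrite ab -natr1 => a1 a2; move: b2; rewrite -natr1 => b2.
by rewrite ltr_norml; apply/andP; split; lra.
Qed.

Lemma natr_dist_ge1 (R : realType) (i j : nat) :
  i != j -> (1 <= `|i%:R - j%:R : R|)%R.
Proof.
by move=> ij; rewrite !pmulrn -intrB -intr_norm ler1z -gtz0_ge1 normr_gt0 subr_eq0.
Qed.

(* Pigeonhole on the cells of side [h] covering ]x - S, x + S[. *)
Lemma pigeonhole (R : realType) (I J : finType) (x : J -> R) (c : I -> J -> R)
    (h S : R) :
  (0 < h)%R -> (0 < S)%R -> (forall i k, `|c i k - x k| < S)%R ->
  (forall i j, i != j -> exists k, (h <= `|c i k - c j k|)%R) ->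
  (#|I|%:R <= (2 * S / h + 1) ^+ #|J|)%R.
Proof.
move=> h0 S0 cx sep; pose m := (Num.truncn (2 * S / h)%R).+1.
have pos i k : (0 <= (c i k - x k + S) / h)%R.
  by rewrite divr_ge0 ?ltW//; have := cx i k; rewrite ltr_norml => /andP[? _]; lra.
(* [F i] is the index vector of the cell of [c i]. [inord] would send an index beyond the range to
   0; [Fm] excludes this. *)
pose F i : {ffun J -> 'I_m} := [ffun k => inord (Num.truncn ((c i k - x k + S) / h)%R)].
have Fm i k : (Num.truncn ((c i k - x k + S) / h)%R < m)%N.
  rewrite ltnS le_truncn// ler_pM2r ?invr_gt0//.
  by have := cx i k; rewrite ltr_norml => /andP[_ ?]; lra.
have Finj : injective F.
  move=> i j Fij; apply/eqP; apply: contraT => /sep[k]; rewrite leNgt => /negP[].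
  have /(congr1 val) := congr1 (fun g : {ffun J -> 'I_m} => g k) Fij.
  rewrite !ffunE /= !inordK// => /(truncn_eq_dist (pos _ _) (pos _ _)).
  rewrite -mulrBl normrM [`|h^-1|%R]gtr0_norm ?invr_gt0// ltr_pdivrMr// mul1r.
  by congr (`|_| < _)%R; lra.
have Sh : (0 <= 2 * S / h)%R by rewrite divr_ge0 ?mulr_ge0 ?ltW.
have mS : (m%:R <= 2 * S / h + 1)%R by rewrite /m -natr1 lerD2r truncn_le.
have := leq_card F Finj; rewrite card_ffun card_ord -(ler_nat R) natrX.
by move=> /le_trans; apply; rewrite lerXn2r ?nnegrE ?addr_ge0.
Qed.

Section euclidean.
Context {R : realType} {d : nat}.
Implicit Types (x y : 'rV[R]_d) (E F : set 'rV[R]_d).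

Lemma ler_coord_euclidean_norm x k : (`|x 0 k| <= euclidean_norm x)%R.
Proof.
rewrite -sqrtr_sqr ler_wsqrtr// (bigD1 k)//= lerDl.
by apply: sumr_ge0 => i _; rewrite sqr_ge0.
Qed.

Lemma euclidean_norm_le_sum x : (euclidean_norm x <= \sum_k `|x 0 k|)%R.
Proof.
have s0 : (0 <= \sum_k `|x 0 k|)%R by apply: sumr_ge0.
rewrite -[leRHS](ger0_norm s0) -sqrtr_sqr ler_wsqrtr//.
rewrite [leRHS]expr2 mulr_suml; apply: ler_sum => i _.
rewrite -real_normK ?num_real// expr2 ler_wpM2l//.
by rewrite (bigD1 i)//= lerDl sumr_ge0.
Qed.

(** A point common to two balls would be within [r] of both centres in every coordinate. The index
    type is arbitrary, so that pairs can index a packing. *)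
Lemma packing_number_ge (I : finType) (r : R) E (c : I -> 'rV[R]_d) :
  (forall i, E (c i)) ->
  (forall i j, i != j -> exists k, (2 * r < `|c i 0 k - c j 0 k|)%R) ->
  #|I|%:R%:E <= packing_number r E.
Proof.
move=> cE sep; apply: ereal_sup_ubound; exists #|I| => //.
exists (c \o enum_val); split=> [i|i j ij]; first exact: cE.
have /sep[k] : enum_val i != enum_val j :> I by rewrite (inj_eq enum_val_inj).
rewrite ltNge => /negP ijk; rewrite -subset0 => y [yi yj]; apply: ijk.
have -> : (c (enum_val i) 0 k - c (enum_val j) 0 k =
    (y - c (enum_val j)) 0 k - (y - c (enum_val i)) 0 k)%R.
  by rewrite !mxE; lra.
have := le_trans (ler_coord_euclidean_norm _ k) yi.
have := le_trans (ler_coord_euclidean_norm _ k) yj.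
by move=> /= kj ki; rewrite (le_trans (ler_normB _ _))//; lra.
Qed.

(** Two centres at distance at most [r] would put [c i] in both balls. The weaker separation [r]
    instead of [2 * r] only affects constants. *)
Lemma packing_number_le (r B : R) E : (0 <= r)%R ->
  (forall n (c : 'I_n -> 'rV[R]_d), (forall i, E (c i)) ->
    (forall i j, i != j -> r < euclidean_norm (c i - c j))%R -> (n%:R <= B)%R) ->
  packing_number r E <= B%:E.
Proof.
move=> r0 H; apply: ge_ereal_sup => _ [n [c [cE disj]] <-]; rewrite lee_fin.
apply: (H n c) => // i j /disj cij; rewrite ltNge; apply/negP => le_r.
have : closed_eball (c i) r `&` closed_eball (c j) r = set0 by [].
rewrite -subset0 => /(_ (c i)); apply; split => //.
rewrite /closed_eball /= subrr (le_trans (euclidean_norm_le_sum _))// big1// => k _.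
by rewrite mxE normr0.
Qed.

(** The condition inside [assouad_dim] with the constant fixed as well, so that countably many pairs
    of exponent and constant can be considered. *)
Definition assouad_bound F (b C : R) : Prop :=
  forall (r S : R) x, (0 < r)%R -> (r < S)%R -> F x ->
    packing_number r (open_eball x S `&` F) <= (C * (S / r) `^ b)%:E.

Lemma assouad_dim_le F (b C : R) :
  (0 < C)%R -> assouad_bound F b C -> assouad_dim F <= b%:E.
Proof. by move=> C0 H; apply: ereal_inf_lbound; exists b => //; exists C. Qed.

End euclidean.

(** * Dimension bounds for graphs *)

Section graph.
Context {R : realType}.
Implicit Types (f : {i01 R} -> R) (r S : R).

Definition graph_point f (x : {i01 R}) : 'rV[R]_2 :=
  \row_(i < 2) (if i == 0%R then x%:num else f x).

Lemma graph_point0 f x : graph_point f x 0%R 0%R = x%:num.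
Proof. by rewrite mxE eqxx. Qed.

Lemma graph_point1 f x : graph_point f x 0%R 1%R = f x.
Proof. by rewrite mxE. Qed.

Lemma euclidean_norm2 (v : 'rV[R]_2) :
  (euclidean_norm v <= `|v 0 0| + `|v 0 1|)%R.
Proof.
rewrite (le_trans (euclidean_norm_le_sum v))// !big_ord_recl big_ord0 addr0.
by rewrite (_ : lift _ _ = 1%R)//; apply/val_inj.
Qed.

(** Planar points more than [r] apart differ by at least [r / 2] in some coordinate, so [pigeonhole]
    bounds their number by (4 S/r + 1)^2, which is at most 25 (S/r)^2 because S/r >= 1. *)
Lemma assouad_dim_graph_le2 f : assouad_dim (graph f) <= 2%:E.
Proof.
apply: (@assouad_dim_le _ _ _ _ 25%R) => // r S x r0 rS Fx.
have S0 : (0 < S)%R by exact: lt_trans rS.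
have Sr : (1 <= S / r)%R by rewrite ler_pdivlMr// mul1r ltW.
apply: packing_number_le; first exact: ltW.
move=> n c cE sep.
have := @pigeonhole R 'I_n 'I_2 (x 0%R) (fun i => c i 0%R) (r / 2)%R S.
rewrite !card_ord => /(_ _ S0) /= H.
apply: le_trans (H _ _ _) _.
- by rewrite divr_gt0.
- move=> i k; have [+ _] := cE i; rewrite /open_eball /=.
  by apply: le_lt_trans; rewrite (le_trans _ (ler_coord_euclidean_norm _ k))// !mxE.
- move=> i j /sep rij.
  have := lt_le_trans rij (euclidean_norm2 _); rewrite !mxE => {}rij.
  have [h|h] := leP (r / 2)%R `|c i 0%R 0%R - c j 0%R 0%R|%R; first by exists 0%R.
  by exists 1%R; lra.
- have -> : (2 * S / (r / 2) = 4 * (S / r))%R by rewrite invf_div; lra.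
  rewrite powR_mulrn; last lra.
  rewrite (_ : 25 = 5 ^+ 2)%R; last lra.
  by rewrite -exprMn lerXn2r ?nnegrE//; lra.
Qed.

Lemma lipschitz_graph f : lipschitz_functions R f ->
  exists2 K : R, (1 <= K)%R & forall x y : {i01 R},
    (`|x%:num - y%:num| + `|f x - f y| <= K * `|x%:num - y%:num|)%R.
Proof.
move=> [k fk]; exists (1 + `|k|)%R => [|x y]; first by rewrite lerDl.
rewrite mulrDl mul1r lerD2l (le_trans (fk x y))// ler_wpM2r//.
exact: ler_norm.
Qed.

(** Graph points more than [r] apart have abscissas at least [r / K] apart, so [pigeonhole] applies
    to the first coordinate alone and gives 2 K S/r + 1 <= (2 K + 1) S/r. *)
Lemma lipschitz_assouad_dim_graph_le1 f :
  lipschitz_functions R f -> assouad_dim (graph f) <= 1.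
Proof.
move=> /lipschitz_graph[K K1 fK]; have K0 : (0 < K)%R by exact: lt_le_trans K1.
apply: (@assouad_dim_le _ _ _ _ (2 * K + 1)%R) => [|r S x r0 rS Fx]; first lra.
have S0 : (0 < S)%R by exact: lt_trans rS.
have Sr : (1 <= S / r)%R by rewrite ler_pdivlMr// mul1r ltW.
apply: packing_number_le; first exact: ltW.
move=> n c cE sep.
have := @pigeonhole R 'I_n unit (fun=> x 0 0)%R (fun i _ => c i 0 0)%R (r / K)%R S.
rewrite card_ord card_unit => /(_ _ S0) /= H.
apply: le_trans (H _ _ _) _.
- by rewrite divr_gt0.
- move=> i _; have [+ _] := cE i; rewrite /open_eball /=.
  by apply: le_lt_trans; rewrite (le_trans _ (ler_coord_euclidean_norm _ 0%R))// !mxE.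
- move=> i j /sep rij; exists tt.
  have := lt_le_trans rij (euclidean_norm2 _).
  have [_ [s ->]] := cE i; have [_ [t ->]] := cE j.
  rewrite !mxE /= => {}rij.
  by rewrite ler_pdivrMr// mulrC (le_trans (ltW rij))// fK.
- rewrite expr1 powRr1; last lra.
  have -> : (2 * S / (r / K) = 2 * K * (S / r))%R by rewrite invf_div; lra.
  lra.
Qed.

(** The [n] graph points over the abscissas i/n lie in one ball of radius [K + 1] and carry disjoint
    balls of radius 1/(3n). An exponent below 1 would give n <= C (3 (K + 1) n)^b for all [n]. *)
Lemma lipschitz_assouad_dim_graph_ge1 f :
  lipschitz_functions R f -> 1 <= assouad_dim (graph f).
Proof.
move=> /lipschitz_graph[K K1 fK]; have K0 : (0 < K)%R by exact: lt_le_trans K1.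
apply: le_ereal_inf_tmp => _ [b [C C0 H] <-]; rewrite lee_fin leNgt.
apply/negP => b1.
have D0 : (0 < (K + 1) * 3)%R by rewrite mulr_gt0// addr_gt0.
have [n n0 /lt_geF/negP] := @powR_natmul_lt R C _ _ _ C0 D0 b1; apply.
have nR0 : (0 < n%:R :> R)%R by rewrite ltr0n.
rewrite powRr1 ?ler0n// -lee_fin.
pose o : {i01 R} := Itv01 (lexx 0%R) ler01.
have r0 : (0 < (n%:R * 3)^-1 :> R)%R by rewrite invr_gt0 mulr_gt0.
have n1 : (1 <= n%:R :> R)%R by rewrite ler1n.
have r1 : ((n%:R * 3)^-1 < K + 1)%R.
  have : ((n%:R * 3)^-1 <= 1 :> R)%R by rewrite invf_le1 ?mulr_gt0//; lra.
  lra.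
have := H _ _ (graph_point f o) r0 r1 (ex_intro _ o erefl).
rewrite invrK -mulrA (mulrC n%:R%R) => /(le_trans _); apply.
have tP (i : 'I_n) : (i%:R / n%:R <= 1 :> R)%R.
  by rewrite ler_pdivrMr// mul1r ler_nat ltnW.
have t0 (i : 'I_n) : (0 <= i%:R / n%:R :> R)%R by rewrite divr_ge0.
pose t i : {i01 R} := Itv01 (t0 i) (tP i).
rewrite -[n in n%:R%:E]card_ord.
apply: (@packing_number_ge _ _ _ _ _ (fun i => graph_point f (t i))).
- move=> i; split; last by exists (t i).
  rewrite /open_eball /= (le_lt_trans (euclidean_norm2 _))// !mxE /=.
  rewrite (le_lt_trans (fK (t i) o))//= subr0 ger0_norm ?t0//.
  by rewrite (@le_lt_trans _ _ K) ?ltrDl// ler_piMr ?tP// ltW.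
- move=> i j ij; exists 0%R; rewrite !graph_point0 /=.
  have N0 : (0 < n%:R^-1 :> R)%R by rewrite invr_gt0.
  rewrite -mulrBl normrM [`|n%:R^-1|%R]gtr0_norm// invfM.
  apply: (@lt_le_trans _ _ n%:R^-1%R); first lra.
  by rewrite ler_peMl ?(ltW N0)// natr_dist_ge1.
Qed.
End graph.

(** * Moduli with nonincreasing slope *)

(** The form in which concavity enters all later arguments; for powers it is checked by computing
    the slope. *)
Definition slope_nonincreasing (R : realType) (w : modulus R) : Prop :=
  forall s t : R, (0 < s)%R -> (s <= t)%R -> (t <= 1)%R -> slope w t <= slope w s.

(** Concavity between 0 and [t] with weight [s / t], together with w(0) = 0. *)
Lemma concave_slope_nonincreasing (R : realType) (w : modulus R) :
  concave_modulus w -> slope_nonincreasing w.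
Proof.
move=> cw s t s0 st t1; have t0 : (0 < t)%R by exact: lt_le_trans st.
have l0 : (0 <= s / t)%R by rewrite divr_ge0 ?ltW.
have l1 : (s / t <= 1)%R by rewrite ler_pdivrMr// mul1r.
have := cw (Itv01 (ltW t0) t1) (Itv01 (lexx 0%R) ler01) (Itv01 l0 l1).
rewrite /= modulus_0 mule0 adde0 mulr0 addr0 divfK ?gt_eqF// => H.
rewrite /slope !inver !gt_eqF// lee_pdivlMr// -muleA -EFinM mulrC.
by rewrite muleC.
Qed.

Lemma holder_slope (R : realType) (a : R) (a0 : (0 < a)%R) (t : R) : (0 < t)%R ->
  slope (holder_modulus a0) t = ((t `^ (1 - a))^-1)%:E.
Proof.
move=> t0; rewrite /slope inver gt_eqF// -EFinM; congr EFin.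
rewrite -powRN opprB powRB; last by rewrite (gt_eqF t0) implybT.
by rewrite powRr1// ltW.
Qed.

Lemma holder_slope_nonincreasing (R : realType) (a : R) (a0 : (0 < a)%R) :
  (a < 1)%R -> slope_nonincreasing (holder_modulus a0).
Proof.
move=> a1 s t s0 st t1; have t0 : (0 < t)%R by exact: lt_le_trans st.
rewrite !holder_slope// lee_fin lef_pV2 ?posrE ?powR_gt0//.
by rewrite ge0_ler_powR ?nnegrE// ?subr_ge0 ltW.
Qed.

Lemma holder_slope_cvg (R : realType) (a : R) (a0 : (0 < a)%R) :
  (a < 1)%R -> slope (holder_modulus a0) t @[t --> 0%R^'+] --> +oo.
Proof.
move=> a1; apply/cvgeyPge => A; pose B := (1 + `|A|)%R.
have B0 : (0 < B)%R by rewrite ltr_pwDl.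
have AB : (A <= B)%R by rewrite (le_trans (ler_norm A))// lerDr.
have a10 : (0 < 1 - a)%R by rewrite subr_gt0.
have /cvgrPdist_lt /(_ B^-1%R) := powR_cvg0 a10.
rewrite invr_gt0 => /(_ B0) H; near=> t.
have t0 : (0 < t)%R by [].
rewrite holder_slope// lee_fin (le_trans AB)//.
rewrite -[leLHS]invrK lef_pV2 ?posrE ?invr_gt0 ?powR_gt0//.
have : (`|0 - t `^ (1 - a)| < B^-1)%R by near: t; exact: H.
by rewrite sub0r normrN ger0_norm ?powR_ge0// => /ltW.
Unshelve. all: by end_near. Qed.

(** A monotone slope always has a limit in the extended reals, namely its supremum on ]0, 1]; only
    +oo is left for it. *)
Lemma not_finite_slope_cvg (R : realType) (w : modulus R) :
  slope_nonincreasing w -> ~ finite_slope w ->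
  slope w t @[t --> 0%R^'+] --> +oo.
Proof.
move=> hw nfw.
have := @nonincreasing_at_right_cvge R (slope w) 0%R (BRight 1%R).
rewrite bnd_simp ltr01 => /(_ isT) H.
set l := ereal_sup _ in H; have {}H : slope w t @[t --> 0%R^'+] --> l.
  apply: H => s t; rewrite !in_itv /= => /andP[s0 _] /andP[_ t1] st; exact: hw.
have [loo|] := ltP l +oo; first by case: nfw; exists l.
by rewrite leye_eq => /eqP loo; rewrite loo in H.
Qed.

Section moduli_with_nonincreasing_slope.
Context {R : realType} (w : modulus R).
Hypothesis hw : slope_nonincreasing w.
Implicit Types (f : {i01 R} -> R) (s t : R) (x y : {i01 R}).

Lemma modulus_ge0_itv t : (0 <= t)%R -> (t <= 1)%R -> 0 <= w t.
Proof. by move=> t0 t1; exact: (modulus_ge0 w (Itv01 t0 t1)). Qed.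

Lemma modulus_gt0_itv t : (0 < t)%R -> (t <= 1)%R -> 0 < w t.
Proof. by move=> t0 t1; exact: (@modulus_gt0 _ w (Itv01 (ltW t0) t1)). Qed.

Lemma modulus_fin_num t : (0 <= t)%R -> (t <= 1)%R -> w t \is a fin_num.
Proof.
rewrite le_eqVlt => /predU1P[<- _|t0 t1]; first by rewrite modulus_0.
have w1 : \forall s \near 0%R^'+, w s < 1.
  have := @modulus_cvg R w [set u | u < 1]; apply.
  exact: (open_ereal_lt' lte01).
have [s [s0 st ws]] : exists s : R, [/\ (0 < s)%R, (s <= t)%R & w s < 1].
  near (0%R : R)^'+ => s; exists s; split.
  - by near: s; exact: nbhs_right_gt.
  - by near: s; exact: nbhs_right_ltW.
  - by near: s.
rewrite ge0_fin_numE ?modulus_ge0_itv ?(ltW t0)//.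
have := hw s0 st t1; rewrite /slope !inver !gt_eqF//.
move: (modulus_ge0_itv (ltW s0) (le_trans st t1)) ws.
case: (w s) => [r| |]// _ _.
by case: (w t) => [u| |]//=; rewrite ?ltry// gt0_mulye ?lte_fin ?invr_gt0.
Unshelve. all: by end_near. Qed.

Local Notation W t := (fine (w t)).

Lemma fine_modulus0 : W 0%R = 0%R.
Proof. by rewrite modulus_0. Qed.

Lemma fine_modulus_gt0 t : (0 < t)%R -> (t <= 1)%R -> (0 < W t)%R.
Proof.
move=> t0 t1; rewrite -lte_fin fineK; first exact: modulus_gt0_itv.
exact: modulus_fin_num (ltW t0) t1.
Qed.

Lemma fine_modulus_ge0 t : (0 <= t)%R -> (t <= 1)%R -> (0 <= W t)%R.
Proof. by move=> t0 t1; rewrite fine_ge0 ?modulus_ge0_itv. Qed.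

Lemma fine_modulus_le s t : (0 <= s)%R -> (s <= t)%R -> (t <= 1)%R ->
  (W s <= W t)%R.
Proof.
move=> s0 st t1; have t0 := le_trans s0 st; have s1 := le_trans st t1.
rewrite -lee_fin !fineK ?modulus_fin_num//.
exact: (@modulus_nondecreasing _ w (Itv01 s0 s1) (Itv01 t0 t1)).
Qed.

Lemma fine_modulus_slope s t : (0 <= s)%R -> (s <= t)%R -> (t <= 1)%R ->
  (s * W t <= t * W s)%R.
Proof.
rewrite le_eqVlt => /predU1P[<- _ _|s0 st t1].
  by rewrite fine_modulus0 mulr0 mul0r.
have t0 : (0 < t)%R by exact: lt_le_trans st.
have := hw s0 st t1; rewrite /slope !inver !gt_eqF//.
have := @modulus_fin_num s (ltW s0) (le_trans st t1).
have := @modulus_fin_num t (ltW t0) t1.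
case: (w t) => // u _; case: (w s) => // v _ /=.
by rewrite lee_fin ler_pdivrMr// mulrAC ler_pdivlMr// mulrC [leRHS]mulrC.
Qed.

(** * From suprema in the extended reals to inequalities between reals *)

Lemma dist_i01 x y : (0 <= `|x%:num - y%:num| <= 1)%R.
Proof. by have [t <-] := dist01 x y; apply/andP. Qed.

Lemma quotient_leP f x y (K : R) : x != y ->
  (quotient w f x y <= K%:E) = (`|f x - f y| <= K * W `|x%:num - y%:num|)%R.
Proof.
move=> xy; have /andP[d0 d1] := dist_i01 x y.
have dp : (0 < `|x%:num - y%:num|)%R by rewrite normr_gt0 subr_eq0.
rewrite /quotient -[w _]fineK ?modulus_fin_num// inver gt_eqF ?fine_modulus_gt0//.
by rewrite -EFinM lee_fin ler_pdivrMr// fine_modulus_gt0.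
Qed.

Lemma local_seminorm_leP f t (K : R) : local_seminorm w f t <= K%:E <->
  (forall x y, `|x%:num - y%:num| <= t ->
    `|f x - f y| <= K * W `|x%:num - y%:num|)%R.
Proof.
split=> [H x y xyt|H].
  have [->|xy] := eqVneq x y; first by rewrite !subrr !normr0 fine_modulus0 mulr0.
  rewrite -quotient_leP//; apply: le_trans H; apply: ereal_sup_ubound.
  by exists x, y.
by apply: ge_ereal_sup => _ [x [y [xy xyt ->]]]; rewrite quotient_leP// H.
Qed.

Lemma seminormE f : seminorm w f = local_seminorm w f 1%R.
Proof.
congr ereal_sup; apply/seteqP; split=> q [x [y]].
  by move=> [xy ->]; exists x, y; split=> //; have /andP[] := dist_i01 x y.
by move=> [xy _ ->]; exists x, y.
Qed.

Lemma seminorm_leP f (K : R) : seminorm w f <= K%:E <->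
  (forall x y, `|f x - f y| <= K * W `|x%:num - y%:num|)%R.
Proof.
rewrite seminormE; split=> [/local_seminorm_leP H x y|H].
  by apply: H; have /andP[] := dist_i01 x y.
by apply/local_seminorm_leP => x y _; exact: H.
Qed.

Lemma big_omegaP f : big_omega w f <->
  exists K, (forall x y, `|f x - f y| <= K * W `|x%:num - y%:num|)%R.
Proof.
rewrite /big_omega /=; split=> [foo|[K /seminorm_leP H]].
  exists (fine (seminorm w f)); apply/seminorm_leP; rewrite fineK//.
  by rewrite ge0_fin_numE ?seminorm_ge0.
exact: le_lt_trans H (ltry _).
Qed.

(** The supremum of an empty set would be -oo; the points 0 and min(t, 1) show that there are pairs
    at distance at most [t]. *)
Lemma local_seminorm_ge0 f t : (0 < t)%R -> 0 <= local_seminorm w f t.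
Proof.
move=> t0; pose s := Num.min t 1%R.
have s0 : (0 < s)%R by rewrite lt_min t0 ltr01.
have s1 : (s <= 1)%R by rewrite ge_min lexx orbT.
pose x : {i01 R} := Itv01 (ltW s0) s1; pose y : {i01 R} := Itv01 (lexx 0%R) ler01.
have xy : x != y by apply/eqP => /(congr1 (fun x => x%:num)) /= /eqP; rewrite gt_eqF.
apply: le_trans (quotient_ge0 w f xy) _; apply: ereal_sup_ubound.
exists x, y; split => //=; rewrite subr0 ger0_norm ?(ltW s0)//.
by rewrite /s ge_min lexx.
Qed.

Lemma is_little_omegaP f : is_little_omega w f <->
  (exists K, (forall x y, `|f x - f y| <= K * W `|x%:num - y%:num|)%R) /\
  (forall e, 0 < e -> exists2 t, 0 < t & forall x y, `|x%:num - y%:num| <= t ->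
    `|f x - f y| <= e * W `|x%:num - y%:num|)%R.
Proof.
split=> [[/big_omegaP bf H]|[bf H]]; split; [by []| |exact/big_omegaP|].
  move=> e e0; have fe : \forall t \near 0%R^'+, local_seminorm w f t < e%:E.
    apply: (H [set u | u < e%:E]).
    by apply: open_ereal_lt'; rewrite lte_fin.
  near (0%R : R)^'+ => t; exists t => //.
  by apply/local_seminorm_leP; apply/ltW; near: t.
have loc e : (0 < e)%R -> \forall t \near 0%R^'+, 0 <= local_seminorm w f t <= e%:E.
  move=> /H[s s0 fs]; near=> t.
  apply/andP; split; first by apply: local_seminorm_ge0.
  apply/local_seminorm_leP => x y xyt; apply: fs; apply: (le_trans xyt).
  by near: t; exact: nbhs_right_ltW.
(* Convergence to 0 in the extended reals splits into eventual finiteness and convergence of the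
   real values. *)
apply/fine_cvgP; split.
  have := loc _ ltr01; apply: filterS => t /andP[f0 f1].
  by rewrite ge0_fin_numE// (le_lt_trans f1)// ltry.
apply/cvgrPdist_le => e /loc; apply: filterS => t /andP[f0 f1] /=.
rewrite sub0r normrN ger0_norm ?fine_ge0//.
by rewrite -lee_fin fineK// ge0_fin_numE// (le_lt_trans f1)// ltry.
Unshelve. all: by end_near. Qed.

Lemma omega_dist_le (f g : little_omega w) (A K : R) :
  (forall x, `|f x - g x| <= A)%R ->
  (forall x y, `|(f x - g x) - (f y - g y)| <= K * W `|x%:num - y%:num|)%R ->
  (omega_dist f g <= A + K)%R.
Proof.
move=> fgA fgK; rewrite -lee_fin fineK ?omega_dist_fin// EFinD.
apply: leeD; first by apply: ge_ereal_sup => _ [x _ <-]; rewrite lee_fin fgA.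
exact/seminorm_leP.
Qed.

Lemma le_omega_dist (f g : little_omega w) x : (`|f x - g x| <= omega_dist f g)%R.
Proof.
rewrite -lee_fin fineK ?omega_dist_fin//.
exact: le_trans (le_supnorm (f \- g)%R x) (leeDl _ (seminorm_ge0 _ _)).
Qed.

(** One [t] with slope at least [C] suffices, since monotonicity passes the bound to every smaller
    [s]. *)
Lemma slope_infty_linear_le (C : R) : slope w t @[t --> 0%R^'+] --> +oo ->
  exists t, [/\ 0 < t, t <= 1 & forall s, 0 <= s -> s <= t -> C * s <= W s]%R.
Proof.
move=> /cvgeyPge /(_ C) H; near (0%R : R)^'+ => t.
have t0 : (0 < t)%R by [].
have t1 : (t <= 1)%R by near: t; exact: nbhs_right_ltW.
exists t; split=> // s s0 st.
have : C%:E <= slope w t by near: t.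
rewrite /slope inver gt_eqF// -[w t]fineK ?modulus_fin_num ?(ltW t0)//.
rewrite -EFinM lee_fin ler_pdivlMr// => Ct.
rewrite -(ler_pM2l t0); apply: le_trans (fine_modulus_slope s0 st t1).
by rewrite mulrCA mulrA [leLHS]mulrC ler_wpM2l.
Unshelve. all: by end_near. Qed.

Lemma modulus_ge_linear x y : (`|x%:num - y%:num| * W 1 <= W `|x%:num - y%:num|)%R.
Proof.
have /andP[d0 d1] := dist_i01 x y.
by have := fine_modulus_slope d0 d1 (lexx _); rewrite mul1r.
Qed.

Lemma lipschitz_big_omega : lipschitz_functions R `<=` big_omega w.
Proof.
move=> f [k fk]; apply/big_omegaP; exists (`|k| / W 1)%R => x y.
have W1 : (0 < W 1)%R by rewrite fine_modulus_gt0.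
apply: le_trans (fk x y) _; apply: (@le_trans _ _ (`|k| * `|x%:num - y%:num|)%R).
  by rewrite ler_wpM2r// ler_norm.
by rewrite -mulrA ler_wpM2l// mulrC ler_pdivlMr// modulus_ge_linear.
Qed.

Lemma finite_slope_big_omega : finite_slope w ->
  big_omega w = lipschitz_functions R.
Proof.
move=> [l loo wl]; apply/seteqP; split; last exact: lipschitz_big_omega.
move=> f /big_omegaP[K fK].
have [C Cl] : exists C : R, l < C%:E.
  by case: (l) loo => [r _| |_] //; [exists (r + 1)%R; rewrite lte_fin ltrDl|
    exists 0%R; rewrite ltNyr].
have nC : \forall t \near 0%R^'+, slope w t < C%:E.
  by apply: (wl [set u | u < C%:E]); exact: open_ereal_lt'.
exists (`|K| * C)%R => x y; apply: (le_trans (fK x y)).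
have /andP[d0 d1] := dist_i01 x y.
apply: (@le_trans _ _ (`|K| * W `|x%:num - y%:num|)%R).
  by rewrite ler_wpM2r ?fine_modulus_ge0// ler_norm.
rewrite -mulrA ler_wpM2l//; set d := `|_|%R in d0 d1 *.
have [->|dn0] := eqVneq d 0%R; first by rewrite fine_modulus0 mulr0.
have dp : (0 < d)%R by rewrite lt_def dn0.
(* The bound [C] on the slope near 0 reaches every distance [d]: compare with a point [t] <= [d]
   close to 0. *)
near (0%R : R)^'+ => t; have t0 : (0 < t)%R by [].
have td : (t <= d)%R by near: t; exact: nbhs_right_ltW.
have : slope w d <= C%:E.
  by apply: (le_trans (hw t0 td d1)); apply/ltW; near: t.
rewrite /slope inver gt_eqF// -[w d]fineK ?modulus_fin_num//.
by rewrite -EFinM lee_fin ler_pdivrMr.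
Unshelve. all: by end_near. Qed.

End moduli_with_nonincreasing_slope.

(** * Flattening and adding a wave *)

Lemma sin_lipschitz (R : realType) (a b : R) : (`|sin a - sin b| <= `|a - b|)%R.
Proof.
wlog ab : a b / (a <= b)%R.
  by move=> H; have [/H//|/ltW/H] := leP a b; rewrite distrC [leRHS]distrC.
have [c _ sinE] := @MVT_segment R sin cos a b ab (fun x _ => is_derive_sin x)
  (continuous_subspaceT (@continuous_sin R)).
by rewrite distrC [leRHS]distrC sinE normrM ler_piMl// cos_max.
Qed.

Lemma sinD2pin (R : realType) (a : R) n : sin (a + 2 * pi * n%:R)%R = sin a.
Proof.
by rewrite -(periodicn (@sinD2pi R) n a) mulr_natr mulr_natl.
Qed.

Section cut.
Context {R : realType}.
Implicit Types (s x y : {i01 R}) (f : {i01 R} -> R).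

(** Maximum and minimum with [s] as points of [{i01 R}]. Composing [f] with [max01 s] freezes it at
    [f s] on [0, s]. *)
Definition max01 s x := if (x%:num <= s%:num)%R then s else x.
Definition min01 s x := if (x%:num <= s%:num)%R then x else s.

Lemma dist_max01 s x y :
  (`|(max01 s x)%:num - (max01 s y)%:num| <= `|x%:num - y%:num|)%R.
Proof.
rewrite /max01; case: (leP x%:num s%:num) => sx; case: (leP y%:num s%:num) => sy;
  rewrite ?subrr ?normr0 ?normr_ge0//.
- by rewrite distrC [leRHS]distrC !ger0_norm; lra.
- by rewrite !ger0_norm; lra.
Qed.

Lemma dist_min01 s x y :
  (`|(min01 s x)%:num - (min01 s y)%:num| <= `|x%:num - y%:num|)%R.
Proof.
rewrite /min01; case: (leP x%:num s%:num) => sx; case: (leP y%:num s%:num) => sy;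
  rewrite ?subrr ?normr0 ?normr_ge0//.
- by rewrite distrC [leRHS]distrC !ger0_norm; lra.
- by rewrite !ger0_norm; lra.
Qed.

Lemma dist_min01_le s x y : (`|(min01 s x)%:num - (min01 s y)%:num| <= s%:num)%R.
Proof.
have minP z : (0 <= (min01 s z)%:num <= s%:num)%R.
  by rewrite /min01; case: (leP z%:num s%:num) => sz; rewrite ?sz ?lexx ge0.
by have /andP[? ?] := minP x; have /andP[? ?] := minP y;
  rewrite ler_norml; apply/andP; split; lra.
Qed.

(** The change caused by flattening only involves values of [f] on [0, s], so the local seminorm at
    scale [s] controls it. *)
Lemma sub_max01 f s x : (f x - f (max01 s x) = f (min01 s x) - f s)%R.
Proof. by rewrite /max01 /min01; case: (leP x%:num s%:num) => // _; rewrite !subrr. Qed.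

End cut.

Section waves.
Context {R : realType}.
Implicit Types (s x y : {i01 R}) (f : {i01 R} -> R) (u : R) (L : nat).

Definition wave L u x : R := (L%:R * u * sin (x%:num / u))%R.

Lemma wave_lipschitz L u x y : (0 < u)%R ->
  (`|wave L u x - wave L u y| <= L%:R * `|x%:num - y%:num|)%R.
Proof.
move=> u0; rewrite -mulrBr normrM ger0_norm ?mulr_ge0 ?(ltW u0)//.
rewrite -mulrA ler_wpM2l// mulrC -ler_pdivlMr//.
apply: le_trans (sin_lipschitz _ _) _.
by rewrite -mulrBl normrM [`|u^-1|%R]ger0_norm// invr_ge0 ltW.
Qed.

Lemma wave_bounded L u x : (0 < u)%R -> (`|wave L u x| <= L%:R * u)%R.
Proof.
move=> u0; rewrite normrM ger0_norm ?mulr_ge0 ?(ltW u0)//.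
by rewrite ler_piMr ?sin_max// mulr_ge0 ?(ltW u0).
Qed.

(** Two regimes: at distances d <= u the slope [L] and d W(u) <= u W(d) give the bound; beyond [u]
    the oscillation is at most 2 L u and W(u) <= W(d). *)
Lemma wave_holder (w : modulus R) L u x y : slope_nonincreasing w ->
  (0 < u)%R -> (u <= 1)%R ->
  (`|wave L u x - wave L u y| <=
    2 * L%:R * u / fine (w u) * fine (w `|x%:num - y%:num|%R))%R.
Proof.
move=> hw u0 u1; have W0 := fine_modulus_gt0 hw u0 u1.
have L0 : (0 <= L%:R :> R)%R by [].
have /andP[d0 d1] := dist_i01 x y; have dW := fine_modulus_ge0 w d0 d1.
rewrite mulrAC ler_pdivlMr//; set d := `|_ - _|%R in d0 d1 dW *.
have [du|ud] := leP d u.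
  apply: (@le_trans _ _ (L%:R * d * fine (w u))%R).
    by rewrite ler_wpM2r ?(ltW W0)// wave_lipschitz.
  rewrite -!mulrA (@le_trans _ _ (L%:R * (u * fine (w d)))%R)//.
    by rewrite ler_wpM2l// fine_modulus_slope.
  have : (0 <= L%:R * (u * fine (w d)))%R by rewrite !mulr_ge0 ?(ltW u0).
  lra.
apply: (@le_trans _ _ (2 * L%:R * u * fine (w u))%R).
  rewrite ler_wpM2r ?(ltW W0)// (le_trans (ler_normB _ _))//.
  by have := wave_bounded L x u0; have := wave_bounded L y u0; lra.
rewrite ler_wpM2l ?mulr_ge0 ?(ltW u0)//.
by rewrite fine_modulus_le// ltW.
Qed.

(* On [0, s] the graph of this function is a translate of that of the wave. *)
Definition flatten_wave f s L u x : R := (f (max01 s x) + wave L u x)%R.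

Section points.
Variables (L : nat) (u : R).
Hypothesis u0 : (0 < u)%R.
Implicit Types i j : 'I_L * 'I_L.

(** In the period numbered by [i.1], the abscissa at which the wave has height [i.2] times [u]. The
    shift [.+1] makes the point nonnegative even with the crude bound asin >= -pi/2. *)
Definition wave_point i : R :=
  (u * (2 * pi * (i.1 : nat).+1%:R + asin ((i.2 : nat)%:R / L%:R)))%R.

Lemma wave_height i : (-1 <= ((i.2 : nat)%:R / L%:R : R) <= 1)%R.
Proof.
case: i => [j k] /=.
have L0 : (0 < L%:R :> R)%R by rewrite ltr0n (leq_trans _ (ltn_ord k)).
rewrite (@le_trans _ _ 0%R) ?divr_ge0//=.
by rewrite ler_pdivrMr// mul1r ler_nat ltnW.
Qed.

Lemma wave_point_ge0 i : (0 <= wave_point i)%R.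
Proof.
rewrite mulr_ge0 ?(ltW u0)// -natr1.
have := asin_geNpi2 (wave_height i); have := @pi_gt0 R.
have : (0 <= pi * (i.1 : nat)%:R :> R)%R by rewrite mulr_ge0 ?pi_ge0.
by lra.
Qed.

(** From pi < 4 and 1 <= L: the periods contribute at most 8 L and the arcsine at most 2 L, so 12
    leaves a margin. *)
Lemma wave_point_le i : (wave_point i <= 12 * L%:R * u)%R.
Proof.
rewrite [leRHS]mulrC ler_wpM2l ?(ltW u0)//.
have := asin_lepi2 (wave_height i); have := @pihalf_lt2 R; have := @pi_gt0 R.
have iL : ((i.1 : nat).+1%:R <= L%:R :> R)%R by rewrite ler_nat.
have i1 : (1 <= (i.1 : nat).+1%:R :> R)%R by rewrite ler1n.
have : (pi * (i.1 : nat).+1%:R <= pi * L%:R :> R)%R by rewrite ler_wpM2l ?pi_ge0.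
have : (L%:R * (pi / 2) <= L%:R * 2 :> R)%R by rewrite ler_wpM2l// ltW ?pihalf_lt2.
by lra.
Qed.

Lemma wave_pointE i (x : {i01 R}) : x%:num = wave_point i ->
  wave L u x = ((i.2 : nat)%:R * u)%R.
Proof.
move=> xE; rewrite /wave xE /wave_point [(u * _)%R]mulrC mulfK ?gt_eqF//.
rewrite addrC sinD2pin asinK ?in_itv/= ?wave_height// mulrAC mulrCA divff ?mulr1//.
by rewrite pnatr_eq0 -lt0n (leq_trans _ (ltn_ord i.2)).
Qed.

(** In units of [u], distinct periods are shifted by at least 2 pi, and two arcsines differ by at
    most pi. *)
Lemma wave_point_sep i j : i.1 != j.1 -> (u <= `|wave_point i - wave_point j|)%R.
Proof.
move=> ij; rewrite -mulrBr normrM gtr0_norm// ler_peMr ?(ltW u0)//.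
have := natr_dist_ge1 R ij; rewrite -!natr1.
have := asin_lepi2 (wave_height i); have := asin_geNpi2 (wave_height i).
have := asin_lepi2 (wave_height j); have := asin_geNpi2 (wave_height j).
have := @pi_ge2 R => p2 a1 a2 a3 a4 D.
have : (pi * 1 <= pi * `|(i.1 : nat)%:R - (j.1 : nat)%:R : R|)%R.
  by rewrite ler_wpM2l// pi_ge0.
by move: D; case: (ler0P ((i.1 : nat)%:R - (j.1 : nat)%:R : R)%R) => _ D pD;
  [rewrite ler0_norm|rewrite ger0_norm]; lra.
Qed.

End points.
End waves.

(** * Approximation in the little space *)

Section flatten_wave_in_little_omega.
Context {R : realType} (w : modulus R).
Hypothesis hw : slope_nonincreasing w.
Hypothesis woo : slope w t @[t --> 0%R^'+] --> +oo.

Local Notation W t := (fine (w t)).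

Lemma flatten_wave_little (f : {i01 R} -> R) s L u : (0 < u)%R ->
  is_little_omega w f ->
  is_little_omega w (flatten_wave f s L u).
Proof.
move=> u0 /(is_little_omegaP hw)[[K fK] flittle].
(* The same estimate serves globally and at small scales: [max01 s] is 1-Lipschitz and [W] is
   monotone, so flattening keeps the constant of [f], and the wave contributes slope [L]. *)
have step e x y : (0 <= e)%R ->
    (`|f (max01 s x) - f (max01 s y)| <=
      e * W `|(max01 s x)%:num - (max01 s y)%:num|)%R ->
    (L%:R * `|x%:num - y%:num| <= e * W `|x%:num - y%:num|)%R ->
    (`|flatten_wave f s L u x - flatten_wave f s L u y| <=
      (e + e) * W `|x%:num - y%:num|)%R.
  move=> e0 fe Le; rewrite /flatten_wave opprD addrACA.
  rewrite (le_trans (ler_normD _ _))// mulrDl lerD//.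
    apply: (le_trans fe); rewrite ler_wpM2l// fine_modulus_le ?dist_max01//.
    by have /andP[] := dist_i01 x y.
  by apply: le_trans Le; exact: wave_lipschitz.
apply/(is_little_omegaP hw); split.
  pose K' := (`|K| + L%:R / W 1)%R.
  have W1 : (0 < W 1)%R by rewrite fine_modulus_gt0.
  have LW : (0 <= L%:R / W 1)%R by rewrite divr_ge0// ltW.
  have K0 : (0 <= K')%R by rewrite addr_ge0.
  exists (K' + K')%R => x y; apply: step => //.
    apply: (le_trans (fK _ _)); rewrite ler_wpM2r//.
      by have /andP[] := dist_i01 (max01 s x) (max01 s y); exact: fine_modulus_ge0.
    by rewrite (le_trans (ler_norm _))// lerDl.
  have /andP[d0 d1] := dist_i01 x y; have := fine_modulus_ge0 w d0 d1.
  move: (modulus_ge_linear hw x y) => WW W0.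
  rewrite mulrDl -[leLHS]add0r lerD ?mulr_ge0//.
  by rewrite -mulrA ler_wpM2l// mulrC ler_pdivlMr.
move=> e e0; have e20 : (0 < e / 2)%R by rewrite divr_gt0.
have [t1 t10 ft] := flittle _ e20.
have [t2 [t20 t21 Lt]] := slope_infty_linear_le hw (L%:R / (e / 2))%R woo.
exists (Num.min t1 t2); first by rewrite lt_min t10 t20.
move=> x y; rewrite le_min => /andP[xy1 xy2].
rewrite [e]splitr; apply: step; first exact: ltW.
  by apply: ft; exact: le_trans (dist_max01 _ _ _) xy1.
by rewrite -ler_pdivrMl// mulrA [(_^-1 * _)%R]mulrC Lt.
Qed.

Lemma flatten_wave_near (f : little_omega w) (L : nat) (e : R) :
  (0 < L)%N -> (0 < e)%R ->
  exists (s : {i01 R}) (u : R) (g : little_omega w),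
    [/\ (0 < u)%R, (12 * L%:R * u <= s%:num)%R,
      little_omega_fun g = flatten_wave f s L u & (omega_dist f g < e)%R].
Proof.
move=> L0 e0; have LR : (0 < L%:R :> R)%R by rewrite ltr0n.
have [[K fK] flittle] := (is_little_omegaP hw f).1 (little_omegaP f).
have W1 : (0 < W 1)%R by rewrite fine_modulus_gt0.
(* Flattening costs at most [c * W 1] in sup norm and [c] in seminorm, [e / 4] together. *)
pose c := (e / (4 * (1 + W 1)))%R.
have c0 : (0 < c)%R by rewrite divr_gt0// mulr_gt0// addr_gt0.
have cE : (c * W 1 + c = e / 4)%R.
  by rewrite /c; field; lra.
have [t t0 ft] := flittle c c0.
pose sr := Num.min t 1%R.
have s0 : (0 < sr)%R by rewrite lt_min t0 ltr01.
have s1 : (sr <= 1)%R by rewrite ge_min lexx orbT.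
have st : (sr <= t)%R by rewrite ge_min lexx.
pose s : {i01 R} := Itv01 (ltW s0) s1.
pose M := (8 * L%:R / e)%R; have M0 : (0 < M)%R by rewrite divr_gt0 ?mulr_gt0.
have [v [v0 v1 Mv]] := slope_infty_linear_le hw M woo.
(* The three bounds on [u]: [v] makes the seminorm of the wave at most [e / 4], the second fits all
   wave points into [0, s], the third makes the amplitude at most [e / 8]. *)
pose u := Num.min v (Num.min (sr / (12 * L%:R)) (e / (8 * L%:R)))%R.
have u0 : (0 < u)%R by rewrite !lt_min v0 !divr_gt0 ?mulr_gt0.
have uv : (u <= v)%R by rewrite ge_min lexx.
have us : (12 * L%:R * u <= sr)%R.
  by rewrite mulrC -ler_pdivlMr ?mulr_gt0// !ge_min lexx orbT.
have ue : (L%:R * u <= e / 8)%R.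
  have : (u <= e / (8 * L%:R))%R by rewrite !ge_min lexx !orbT.
  by rewrite ler_pdivlMr ?mulr_gt0//; lra.
have u1 : (u <= 1)%R by exact: le_trans uv v1.
have Wu : (0 < W u)%R by rewrite fine_modulus_gt0.
have LW : (2 * L%:R * u / W u <= e / 4)%R.
  rewrite ler_pdivrMr//; have := Mv u (ltW u0) uv.
  rewrite /M mulrAC ler_pdivrMr//; lra.
exists s, u, (LittleOmega (flatten_wave_little s L u0 (little_omegaP f))).
split=> //; have fmin x y : (`|f (min01 s x) - f (min01 s y)| <=
    c * W `|(min01 s x)%:num - (min01 s y)%:num|)%R.
  by apply: ft; apply: (@le_trans _ _ sr) => //; exact: (dist_min01_le s x y).
(* Sup norm part plus seminorm part; the total is 5 e / 8. *)
apply: (@le_lt_trans _ _ ((c * W 1 + e / 8) + (c + e / 4))%R); last lra.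
have sub_g x : (f x - flatten_wave f s L u x = f (min01 s x) - f s - wave L u x)%R.
  by rewrite -sub_max01 /flatten_wave opprD addrA.
apply: omega_dist_le => // [x|x y] /=; rewrite !sub_g.
  rewrite (le_trans (ler_normB _ _))// lerD//.
    have ss : min01 s s = s by rewrite /min01 lexx.
    rewrite -{2}ss (le_trans (fmin _ _))// ler_wpM2l ?(ltW c0)//.
    by have /andP[? ?] := dist_i01 (min01 s x) (min01 s s); rewrite fine_modulus_le.
  exact: le_trans (wave_bounded _ _ u0) ue.
have -> : (f (min01 s x) - f s - wave L u x - (f (min01 s y) - f s - wave L u y) =
   (f (min01 s x) - f (min01 s y)) - (wave L u x - wave L u y))%R by lra.
have /andP[d0 d1] := dist_i01 x y.
rewrite (le_trans (ler_normB _ _))// mulrDl lerD//.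
  by rewrite (le_trans (fmin _ _))// ler_wpM2l ?(ltW c0)// fine_modulus_le ?dist_min01.
apply: le_trans (wave_holder L x y hw u0 u1) _.
by rewrite ler_wpM2r// fine_modulus_ge0.
Qed.

End flatten_wave_in_little_omega.

(** Wave points in different periods have abscissas at least [u] apart; in the same period the
    heights differ by at least [u], hence by 3 u / 4 after the perturbation. Both exceed u / 2,
    twice the packing radius. *)
Lemma packing_near_flatten_wave (R : realType) (f h : {i01 R} -> R) s (L : nat)
    (u : R) :
  (0 < L)%N -> (0 < u)%R -> (12 * L%:R * u <= s%:num)%R ->
  (forall x, `|flatten_wave f s L u x - h x| <= u / 8)%R ->
  (L ^ 2)%:R%:E <= packing_number (u / 4)%R
    (open_eball (graph_point h (Itv01 (lexx 0%R) ler01)) (20 * L%:R * u)%R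
      `&` graph h).
Proof.
move=> L0 u0 us gh; set o : {i01 R} := Itv01 _ _.
have LR : (1 <= L%:R :> R)%R by rewrite ler1n.
have uL : (u <= L%:R * u)%R by rewrite ler_peMl// ltW.
have tP (i : 'I_L * 'I_L) : exists x : {i01 R},
    x%:num = wave_point u i :> R /\ (x%:num <= s%:num)%R.
  have t0 := wave_point_ge0 u0 i; have ts := le_trans (wave_point_le u0 i) us.
  have t1 : (wave_point u i <= 1)%R by exact: le_trans ts _.
  by exists (Itv01 t0 t1).
pose t i := sval (cid (tP i)).
have tE i : (t i)%:num = wave_point u i by rewrite /t; case: cid => ? [].
have ts i : ((t i)%:num <= s%:num)%R by rewrite /t; case: cid => ? [].
have gt i : flatten_wave f s L u (t i) = (f s + (i.2 : nat)%:R * u)%R.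
  by rewrite /flatten_wave (wave_pointE u0 (tE i)) /max01 ts.
have go : flatten_wave f s L u o = f s.
  by rewrite /flatten_wave /wave /max01 /= mul0r sin0 mulr0 addr0 ge0.
have ht i : (`|h (t i) - (f s + (i.2 : nat)%:R * u)| <= u / 8)%R.
  by rewrite -gt distrC.
have ho : (`|h o - f s| <= u / 8)%R by rewrite -{1}go distrC.
have -> : (L ^ 2)%N = #|{: 'I_L * 'I_L}| by rewrite card_prod card_ord mulnn.
apply: (@packing_number_ge _ _ _ _ _ (fun i => graph_point h (t i))) => [i|i j ij].
  split; last by exists (t i).
  rewrite /open_eball /= (le_lt_trans (euclidean_norm2 _))// !mxE /= subr0.
  rewrite tE ger0_norm ?wave_point_ge0//.
  have iL : ((i.2 : nat)%:R * u <= L%:R * u)%R.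
    by rewrite ler_wpM2r ?(ltW u0)// ler_nat ltnW.
  have i0 : (0 <= (i.2 : nat)%:R * u)%R by rewrite mulr_ge0 ?(ltW u0).
  (* Horizontally at most 12 L u, vertically at most L u + u / 4: the sum is below 20 L u. *)
  have := wave_point_le u0 i; move: (ht i) ho; rewrite !ler_norml.
  move=> /andP[? ?] /andP[? ?] ?.
  have : (`|h (t i) - h o| <= L%:R * u + u / 4)%R.
    by rewrite ler_norml; apply/andP; split; lra.
  lra.
have [i1|/(wave_point_sep u0)] := eqVneq i.1 j.1; last first.
  by move=> ijt; exists 0%R; rewrite !graph_point0 !tE; lra.
have i2 : i.2 != j.2.
  by apply: contraNneq ij => i2; rewrite [i]surjective_pairing i1 i2 -surjective_pairing.
exists 1%R; rewrite !graph_point1.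
have : (1 * u <= `|(i.2 : nat)%:R - (j.2 : nat)%:R| * u)%R.
  by rewrite ler_wpM2r ?(ltW u0)// natr_dist_ge1.
rewrite -{2}(gtr0_norm u0) -normrM mulrBl mul1r.
have -> : ((i.2 : nat)%:R * u - (j.2 : nat)%:R * u =
  (h (t i) - h (t j)) - (h (t i) - (f s + (i.2 : nat)%:R * u))
   + (h (t j) - (f s + (j.2 : nat)%:R * u)))%R by lra.
move=> H; have := le_trans H (ler_normD _ _).
have := ler_normB (h (t i) - h (t j))%R (h (t i) - (f s + (i.2 : nat)%:R * u))%R.
move: (ht i) (ht j); lra.
Qed.

(** * Typical functions *)

Section category_lemmas.
Context {T : topologicalType}.

Lemma nowhere_dense_subset (A B : set T) : A `<=` B ->
  nowhere_dense B -> nowhere_dense A.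
Proof.
move=> AB B0; rewrite /nowhere_dense -subset0 -B0.
exact/interiorS/closure_subset.
Qed.

(** [meagre] asks for an equality, so the cover is cut down by intersecting with [A]. *)
Lemma meagre_subset_bigcup (A : set T) (F : (set T)^nat) :
  (forall n, nowhere_dense (F n)) -> A `<=` \bigcup_n F n -> meagre A.
Proof.
move=> F0 AF; exists (fun n => F n `&` A).
  by move=> n; apply: nowhere_dense_subset (F0 n); exact: subIsetl.
by rewrite -setI_bigcupl; apply/seteqP; split=> [x Ax|x []//]; split => //; exact: AF.
Qed.

End category_lemmas.

Section typical.
Context {R : realType} (w : modulus R).
Hypothesis hw : slope_nonincreasing w.
Hypothesis woo : slope w t @[t --> 0%R^'+] --> +oo.

Lemma nowhere_dense_assouad_bound (b C : R) : (0 < C)%R -> (b < 2)%R ->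
  nowhere_dense [set f : little_omega w | assouad_bound (graph f) b C].
Proof.
move=> C0 b2; rewrite /nowhere_dense -subset0 => f.
rewrite /interior /= => /nbhs_ballP[e /= e0 fe].
(* 80 L is the ratio of the ball radius 20 L u to the packing radius u / 4. *)
have [L L0 CL] := @powR_natmul_lt R C 80%R b 2%R C0 ltac:(lra) b2.
have [s [u [g [u0 us gE fg]]]] := flatten_wave_near hw woo f L0 e0.
have : ball f e g by rewrite ballEmdist.
(* As [g] lies in the closure, some [h] within [u / 8] of it satisfies the bound, against its
   packing of L^2 balls. *)
move=> /fe /(_ (ball g (u / 8)%R)) [].
  by apply: nbhsx_ballx; rewrite divr_gt0.
move=> h [hb]; rewrite ballEmdist => gh.
have {gh} gh : (omega_dist g h < u / 8)%R by [].
have LR : (1 <= L%:R :> R)%R by rewrite ler1n.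
have uL : (u <= L%:R * u)%R by rewrite ler_peMl// ltW.
have := @packing_near_flatten_wave R f h s L u L0 u0 us _.
rewrite -gE => /(_ (fun x => le_trans (le_omega_dist g h x) (ltW gh))).
set o : {i01 R} := Itv01 _ _ => Lp.
have := hb (u / 4)%R (20 * L%:R * u)%R (graph_point h o) _ _ (ex_intro _ o erefl).
rewrite divr_gt0// => /(_ isT).
rewrite (_ : u / 4 < 20 * L%:R * u)%R; last lra.
move=> /(_ isT) /(le_trans Lp); rewrite lee_fin.
have -> : (20 * L%:R * u / (u / 4) = 80 * L%:R)%R by field; lra.
by rewrite natrX -powR_mulrn// leNgt CL.
Qed.

(** A bound with some b < 2 and [C] implies one with exponent 2 - 1/(n + 1) and constant n + 1 for
    large [n], as S/r >= 1. Thus countably many nowhere dense sets cover the exceptions. *)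
Lemma typical_assouad_dim :
  residual [set f : little_omega w | assouad_dim (graph f) = 2%:E].
Proof.
apply: (@meagre_subset_bigcup _ _ (fun n =>
  [set f : little_omega w | assouad_bound (graph f) (2 - n.+1%:R^-1)%R n.+1%:R])).
  move=> n; apply: nowhere_dense_assouad_bound => //.
  by rewrite ltrBlDr ltrDl invr_gt0.
move=> f /= f2; have : assouad_dim (graph f) < 2%:E.
  by rewrite lt_neqAle assouad_dim_graph_le2 andbT; apply/eqP.
move=> /ereal_inf_lt[_ [b [C C0 H] <-]]; rewrite lte_fin => b2.
(* Then n + 1 exceeds both [C] and 1/(2 - b), both summands being positive. *)
pose n := (Num.truncn (C + (2 - b)^-1)%R).
have nC : (C + (2 - b)^-1 < n.+1%:R)%R by exact: truncnS_gt.
have b20 : (0 < (2 - b)^-1)%R by rewrite invr_gt0 subr_gt0.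
have bn : (b <= 2 - n.+1%:R^-1)%R.
  rewrite lerBrDr -lerBrDl -[leRHS]invrK lef_pV2 ?posrE//; lra.
exists n => // r S x r0 rS fx; apply: le_trans (H r S x r0 rS fx) _.
have rS1 : (1 <= S / r)%R by rewrite ler_pdivlMr// mul1r ltW.
rewrite lee_fin ler_pM ?powR_ge0 ?(ltW C0)//; first lra.
by rewrite ler_powR.
Qed.

End typical.

(** * The dichotomy for concave moduli, and powers *)

Unset Implicit Arguments.

Theorem theorem2p5 (R : realType) :
  (forall w : modulus R, concave_modulus w ->
    (finite_slope w ->
      big_omega w = lipschitz_functions R /\
      forall f : {i01 R} -> R, big_omega w f -> assouad_dim (graph f) = 1) /\
    (~ finite_slope w ->
      slope w t @[t --> 0%R^'+] --> +oo /\
      residual [set f : little_omega w | assouad_dim (graph f) = 2%:E])) /\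
  (forall (a : R) (a0 : (0 < a)%R), (a < 1)%R ->
    residual [set f : little_omega (holder_modulus a0) |
      assouad_dim (graph f) = 2%:E]).
Proof.
split=> [w /concave_slope_nonincreasing hw|a a0 a1]; last first.
  by apply: typical_assouad_dim;
    [exact: holder_slope_nonincreasing|exact: holder_slope_cvg].
split=> [fw|nfw].
  have wE := finite_slope_big_omega hw fw; split=> // f; rewrite wE => lf.
  apply/eqP; rewrite eq_le lipschitz_assouad_dim_graph_le1//.
  exact: lipschitz_assouad_dim_graph_ge1.
have woo := not_finite_slope_cvg hw nfw.
by split=> //; exact: typical_assouad_dim.
Qed.
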